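(* Every bounded FC-solvable group $G$ is solvable-by-finite; that is, $G$ has a normal solvable subgroup of finite index.
   Context: A group $A$ is an FC-group if every element of $A$ has only finitely many conjugates in $A$; it is a bounded FC-group if there is a natural number $m$ such that every conjugacy class of $A$ has at most $m$ elements. A group $G$ is FC-solvable of length $n$ if it admits a finite chain $\{1\}=G_0\le G_1\le\dots\le G_n=G$ of normal subgroups of $G$ such that each factor $G_{i+1}/G_i$ ($0\le i<n$) is an FC-group. A group $G$ is bounded FC-solvable of length $n$ if it is FC-solvable of length $n$ and, in a chain of normal subgroups witnessing this, each factor $G_{i+1}/G_i$ is a bounded FC-group. A group is bounded FC-solvable if it is bounded FC-solvable of some length $n$. *)

(* Defs.v *)
From HB Require Import structures.
From mathcomp Require Import all_boot.
From mathcomp Require Import boolp classical_sets functions cardinality.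

Set Implicit Arguments.
Unset Strict Implicit.
Unset Printing Implicit Defensive.

Local Open Scope group_scope.
Local Open Scope quotient_scope.
Local Open Scope classical_set_scope.
Local Open Scope card_scope.

(* As for finite groups in MathComp, a "group" below is a subset A of an      *)
(* ambient group G that is a subgroup; the ambient group is [set: G].         *)
(* A groupType carries a choice structure; under the classical axioms every   *)
(* type has one (boolp.gen_choiceMixin), so this loses no generality.         *)

Definition subgroup (G : groupType) (A : set G) : Prop :=
  [/\ A 1, (forall x y, A x -> A y -> A (x * y)) & forall x, A x -> A x^-1].

Record normal_subgroup (G : groupType) := NormalSubgroup {
  normal_set :> set G;
  normal_subgroupP : subgroup normal_set;
  normal_conjP : forall x y, normal_set x -> normal_set (x ^ y)
}.

Section Quotient.
Variables (G : groupType) (N : normal_subgroup G).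

Lemma normal1 : normal_set N 1. Proof. by case: (normal_subgroupP N). Qed.
Lemma normalM x y : normal_set N x -> normal_set N y -> normal_set N (x * y).
Proof. by case: (normal_subgroupP N) => _ M _; exact: M. Qed.
Lemma normalV x : normal_set N x -> normal_set N x^-1.
Proof. by case: (normal_subgroupP N) => _ _ V; exact: V. Qed.

(* Left cosets: x and y are identified when x N = y N. *)
Definition coset_rel (x y : G) : bool := `[< normal_set N (x^-1 * y) >].

Lemma coset_rel_refl : reflexive coset_rel.
Proof. by move=> x; apply/asboolP; rewrite mulVg; exact: normal1. Qed.

Lemma coset_rel_sym : symmetric coset_rel.
Proof.
by move=> x y; apply/asboolP/asboolP => /normalV; rewrite invgM invgK.
Qed.

Lemma coset_rel_trans : transitive coset_rel.
Proof.
move=> y x z /asboolP xy /asboolP yz; apply/asboolP.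
by have := normalM xy yz; rewrite -mulgA mulVKg.
Qed.

Canonical coset_equiv :=
  EquivRel coset_rel coset_rel_refl coset_rel_sym coset_rel_trans.

Definition quotient := {eq_quot coset_rel}.
HB.instance Definition _ := Choice.on quotient.
HB.instance Definition _ := EqQuotient.on quotient.

Definition coset (x : G) : quotient := \pi x.

Lemma cosetP x y : coset x = coset y <-> normal_set N (x^-1 * y).
Proof.
split; first by move/eqmodP/asboolP.
by move=> xy; apply/eqmodP/asboolP.
Qed.

Lemma coset_repr (a : quotient) : coset (repr a) = a.
Proof. exact: reprK. Qed.

Definition quotient_mul (a b : quotient) : quotient :=
  coset (repr a * repr b).
Definition quotient_inv (a : quotient) : quotient := coset (repr a)^-1.

Lemma coset_mul x y : quotient_mul (coset x) (coset y) = coset (x * y).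
Proof.
set x' := repr (coset x); set y' := repr (coset y).
have /cosetP Nx : coset x' = coset x by exact: coset_repr.
have /cosetP Ny : coset y' = coset y by exact: coset_repr.
apply/cosetP; have := normalM (normal_conjP y' Nx) Ny.
by rewrite /conjg invgM !mulgA !mulgK.
Qed.

Lemma coset_inv x : quotient_inv (coset x) = coset x^-1.
Proof.
set x' := repr (coset x).
have /cosetP Nx : coset x' = coset x by exact: coset_repr.
apply/cosetP; have := normalV (normal_conjP x'^-1 Nx).
by rewrite /conjg !invgM !invgK !mulgA mulgK.
Qed.

Lemma quotient_mulA : associative quotient_mul.
Proof.
move=> a b c; rewrite -(coset_repr a) -(coset_repr b) -(coset_repr c).
by rewrite !coset_mul mulgA.
Qed.

Lemma quotient_mul1 : left_id (coset 1) quotient_mul.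
Proof. by move=> a; rewrite -(coset_repr a) coset_mul mul1g. Qed.

Lemma quotient_mulr1 : right_id (coset 1) quotient_mul.
Proof. by move=> a; rewrite -(coset_repr a) coset_mul mulg1. Qed.

Lemma quotient_mulV : left_inverse (coset 1) quotient_inv quotient_mul.
Proof.
by move=> a; rewrite -(coset_repr a) coset_inv coset_mul mulVg.
Qed.

Lemma quotient_mulrV : right_inverse (coset 1) quotient_inv quotient_mul.
Proof.
by move=> a; rewrite -(coset_repr a) coset_inv coset_mul mulgV.
Qed.

HB.instance Definition _ := isGroup.Build quotient
  quotient_mulA quotient_mul1 quotient_mulr1 quotient_mulV quotient_mulrV.

Lemma cosetM x y : coset (x * y) = coset x * coset y.
Proof. by rewrite -coset_mul. Qed.

(* H / N, as a subgroup of the group quotient N; used with N `<=` H. *)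
Definition factor (H : set G) : set quotient := coset @` H.

End Quotient.

Arguments coset {G} N x.
Arguments factor {G} N H.

Definition conj_class (G : groupType) (A : set G) (x : G) : set G :=
  [set x ^ y | y in A].

Definition FC_group (G : groupType) (A : set G) : Prop :=
  forall x, A x -> finite_set (conj_class A x).

(* `I_m has exactly m elements. *)
Definition bounded_FC_group (G : groupType) (A : set G) : Prop :=
  exists m : nat, forall x, A x -> conj_class A x #<= `I_m.

(* Only the values N 0, ..., N n of the sequence matter. *)
Definition normal_chain (G : groupType) (n : nat)
    (N : nat -> normal_subgroup G) : Prop :=
  [/\ N 0 = [set 1] :> set G,
      N n = setT :> set G &
      forall i, (i < n)%N -> N i `<=` N i.+1].

Definition FC_chain (G : groupType) (n : nat)
    (N : nat -> normal_subgroup G) : Prop :=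
  normal_chain n N /\
  forall i, (i < n)%N -> FC_group (factor (N i) (N i.+1)).

Definition bounded_FC_solvable_of_length (G : groupType) (n : nat) : Prop :=
  exists N : nat -> normal_subgroup G, FC_chain n N /\
  forall i, (i < n)%N -> bounded_FC_group (factor (N i) (N i.+1)).

Definition bounded_FC_solvable (G : groupType) : Prop :=
  exists n, bounded_FC_solvable_of_length G n.

Definition commutators (G : groupType) (A : set G) : set G :=
  [set [~ x, y] | x in A & y in A].

Definition derived_subgroup (G : groupType) (A : set G) : set G :=
  smallest (@subgroup G) (commutators A).

(* The derived series of A reaches the trivial group. *)
Definition solvable_group (G : groupType) (A : set G) : Prop :=
  exists n, iter n (@derived_subgroup G) A = [set 1].

Definition solvable_by_finite (G : groupType) : Prop :=
  exists N : normal_subgroup G,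
    solvable_group N /\ finite_set [set: quotient N].

(* Main.v *)
(* Going up the chain, one shows that each term has a solvable subgroup of finite
   index which is normal in the whole group.  Given such an R in N_i, Neumann's
   argument yields a subgroup of finite index in N_{i+1} that is nilpotent of
   class 2 modulo N_i; intersected with the centraliser of the finite group
   N_i / R it becomes solvable.  A normal solvable subgroup of minimal finite
   index contains its conjugates, hence is normal in the whole group.  The full
   strength of Neumann's theorem (finiteness of the derived subgroup) is thus
   avoided. *)
Require Import Defs.
From mathcomp Require Import all_boot.
From mathcomp Require Import boolp classical_sets functions cardinality.

Set Implicit Arguments.
Unset Strict Implicit.
Unset Printing Implicit Defensive.

Local Open Scope group_scope.
Local Open Scope classical_set_scope.
Local Open Scope card_scope.

(** * Subgroups and their derived series *)

Section Subgroups.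
Variable G : groupType.
Implicit Types (A B M N R W : set G) (x y z : G).

Definition normalized_by A B := forall x y, A x -> B y -> A (x ^ y).

Lemma subgroupI A B : subgroup A -> subgroup B -> subgroup (A `&` B).
Proof.
move=> [A1 AM AV] [B1 BM BV]; split=> //.
- by move=> x y [Ax Bx] [Ay By]; split; [exact: AM|exact: BM].
- by move=> x [Ax Bx]; split; [exact: AV|exact: BV].
Qed.

Lemma subgroupJ A x y : subgroup A -> A x -> A y -> A (x ^ y).
Proof. by move=> [_ AM AV] Ax Ay; apply: (AM); [exact: AV|exact: AM]. Qed.

Lemma subgroupR A x y : subgroup A -> A x -> A y -> A [~ x, y].
Proof.
move=> sA Ax Ay; case: (sA) => _ AM AV.
by apply: AM; [exact: AV|exact: subgroupJ].
Qed.

Lemma derived_subgroup_subgroup A : subgroup (derived_subgroup A).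
Proof.
split=> [B [[B1 _ _] _] //|x y Ax Ay B sAB|x Ax B sAB].
- by case: (sAB) => -[_ BM _] _; apply: BM; [exact: Ax|exact: Ay].
- by case: (sAB) => -[_ _ BV] _; apply: BV; exact: Ax.
Qed.

Lemma mem_derived A x y : A x -> A y -> derived_subgroup A [~ x, y].
Proof. by move=> Ax Ay B [_]; apply; exists x => //; exists y. Qed.

Lemma derived_subgroup_sub A B : subgroup B ->
  (forall x y, A x -> A y -> B [~ x, y]) -> derived_subgroup A `<=` B.
Proof. by move=> sB AB x; apply; split=> // _ [u Au [v Av <-]]; exact: AB. Qed.

Lemma iter_derived_subgroup A n :
  subgroup A -> subgroup (iter n (@derived_subgroup G) A).
Proof. by case: n => //= n _; exact: derived_subgroup_subgroup. Qed.

Lemma iter_derived_sub A n :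
  subgroup A -> iter n (@derived_subgroup G) A `<=` A.
Proof.
move=> sA; elim: n => //= n IHn.
apply: derived_subgroup_sub => // x y /IHn Ax /IHn Ay.
exact: subgroupR.
Qed.

(** Each term of the series contains [1], so inclusion in the trivial group is already equality. *)
Lemma solvable_group_sub A n : subgroup A ->
  iter n (@derived_subgroup G) A `<=` [set 1] -> solvable_group A.
Proof.
move=> sA A1; exists n; apply/seteqP; split=> // _ ->.
by case: (iter_derived_subgroup n sA).
Qed.

End Subgroups.

(** Preimages of subgroups under a multiplicative map are subgroups, so each step need only be
    checked on commutators. The lemma serves for inclusions, conjugations and the projection
    [coset N]. *)
Lemma iter_derived_morph (G H : groupType) (f : G -> H) A B n :
    {morph f : x y / x * y} -> subgroup B -> (forall x, A x -> B (f x)) ->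
  forall x, iter n (@derived_subgroup G) A x ->
            iter n (@derived_subgroup H) B (f x).
Proof.
move=> fM sB AB.
have f1 : f 1 = 1 by apply: (mulgI (f 1)); rewrite -fM !mulg1.
have fV x : f x^-1 = (f x)^-1.
  by apply: (mulgI (f x)); rewrite -fM !mulgV.
elim: n => //= n IHn.
set Bn := iter n _ B in IHn *.
have [D1 DM DV] := derived_subgroup_subgroup Bn.
apply: (@derived_subgroup_sub _ _ (f @^-1` derived_subgroup Bn)).
  split=> [|x y|x]; rewrite /preimage /= ?f1 ?fM ?fV //; [exact: DM|exact: DV].
move=> x y /IHn Bx /IHn By; rewrite /preimage /= /commg /conjg !fM !fV.
exact: mem_derived.
Qed.

Lemma iter_derived_mono (G : groupType) (A B : set G) n : subgroup B ->
  A `<=` B ->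
  iter n (@derived_subgroup G) A `<=` iter n (@derived_subgroup G) B.
Proof. by move=> sB AB x; apply: (@iter_derived_morph _ _ id). Qed.

Lemma solvable_group_conj (G : groupType) (A : set G) y : subgroup A ->
  solvable_group A -> solvable_group [set x | A (x ^ y)].
Proof.
move=> sA [n An]; apply: (@solvable_group_sub _ _ n).
  case: sA => A1 AM AV; split=> [|u v|u] /=; rewrite ?conj1g ?conjMg ?conjVg //.
  - exact: AM.
  - exact: AV.
move=> x /(@iter_derived_morph _ _ (conjg^~ y) _ A).
rewrite An => /(_ (fun u v => conjMg u v y) sA (fun _ h => h)) /eqP.
by rewrite conjg_eq1 => /eqP.
Qed.

(** * Products of two subgroups, the second normalising the first *)

Section Product.
Variable G : groupType.
Implicit Types (A B M : set G).

Definition mul_set A B := [set x * y | x in A & y in B].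

Lemma mul_set_subgroup A B :
  subgroup A -> subgroup B -> normalized_by A B -> subgroup (mul_set A B).
Proof.
move=> [A1 AM AV] [B1 BM BV] nAB; split.
- by exists 1 => //; exists 1 => //; rewrite mulg1.
- move=> _ _ [a Aa [b Bb <-]] [a' Aa' [b' Bb' <-]].
  exists (a * a' ^ b^-1); first by apply: AM => //; apply: nAB => //; exact: BV.
  by exists (b * b'); [exact: BM|rewrite /conjg !gnorm].
- move=> _ [a Aa [b Bb <-]].
  exists (a^-1 ^ b); first by apply: nAB => //; exact: AV.
  by exists b^-1; [exact: BV|rewrite /conjg !gnorm].
Qed.

(** Modulo [A], the commutator of [a * b] and [a' * b'] is [[~ b, b']]; since [B] normalises [A],
    all other factors can be collected on the left. A general [X] is allowed because the iteration
    only knows that a term of the series lies inside such a product. *)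
Lemma mul_set_derived A B X : subgroup A -> subgroup B -> normalized_by A B ->
  X `<=` mul_set A B -> derived_subgroup X `<=` mul_set A (derived_subgroup B).
Proof.
move=> sA sB nAB XAB; have [A1 AM AV] := sA; have [B1 BM BV] := sB.
apply: derived_subgroup_sub.
  apply: mul_set_subgroup => //; first exact: derived_subgroup_subgroup.
  by move=> x y Ax /(@iter_derived_sub _ _ 1 sB) By; exact: nAB.
move=> _ _ /XAB[a Aa [b Bb <-]] /XAB[a' Aa' [b' Bb' <-]].
exists (a^-1 ^ b * (a'^-1 * a) ^ (b' * b) * a' ^ (b' ^ b)).
  apply: (AM); first apply: (AM); apply: nAB.
  - exact: AV.
  - by [].
  - by apply: AM => //; exact: AV.
  - exact: BM.
  - by [].
  - exact: subgroupJ.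
exists [~ b, b']; first exact: mem_derived.
by rewrite /commg /conjg !gnorm.
Qed.

Lemma mul_set_solvable A B : subgroup A -> subgroup B -> normalized_by A B ->
  solvable_group A -> solvable_group B -> solvable_group (mul_set A B).
Proof.
move=> sA sB nAB [m Am] [n Bn].
apply: (@solvable_group_sub _ _ (m + n)); first exact: mul_set_subgroup.
rewrite iterD -Am; apply: iter_derived_mono => //.
suff : iter n (@derived_subgroup G) (mul_set A B)
        `<=` mul_set A (iter n (@derived_subgroup G) B).
  by rewrite Bn => sub x /sub[a Aa [_ -> <-]]; rewrite mulg1.
elim: n {Bn} => //= n IHn; apply: mul_set_derived => //.
  exact: iter_derived_subgroup.
by move=> x y Ax /(iter_derived_sub sB) By; exact: nAB.
Qed.

End Product.

(* The left cosets of [A] meeting [M] are separated by a map to a finite type. *)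
Definition finite_index (G : groupType) (M A : set G) : Prop :=
  exists (I : finType) (f : G -> I),
    forall x y, M x -> M y -> f x = f y -> A (x^-1 * y).

(** * Finite index: cores, centralisers of finite factors, normal solvable subgroups *)

Section FiniteIndex.
Variable G : groupType.
Implicit Types (A B M N R W : set G).

Lemma finite_indexI M A B :
  finite_index M A -> finite_index M B -> finite_index M (A `&` B).
Proof.
move=> [I [f fA]] [J [g gB]]; exists (I * J)%type, (fun x => (f x, g x)).
by move=> x y Mx My [fxy gxy]; split; [exact: fA|exact: gB].
Qed.

Lemma finite_indexS M N A B :
  N `<=` M -> A `<=` B -> finite_index M A -> finite_index N B.
Proof.
move=> NM AB [I [f fA]]; exists I, f => x y /NM Mx /NM My fxy.
by apply: AB; exact: fA.
Qed.

Lemma finite_index_image (T : choiceType) M A (f : G -> T) :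
  finite_set (f @` M) ->
  (forall x y, M x -> M y -> f x = f y -> A (x^-1 * y)) -> finite_index M A.
Proof.
move=> /finite_seqP[s fMs] fA.
have fs x : M x -> f x \in s.
  by move=> Mx; have : [set` s] (f x) by rewrite -fMs; exists x.
have ltf x : M x -> index (f x) s < (size s).+1.
  by move=> /fs; rewrite ltnS => _; exact: index_size.
(* The successor makes the ordinal type inhabited, as [inord] requires; on [M] the index stays below
   [size s]. *)
exists 'I_(size s).+1, (fun x => inord (index (f x) s)) => x y Mx My.
move=> /(congr1 val); rewrite /= !inordK ?ltf // => fxy.
apply: fA => //.
by rewrite -[f x](nth_index (f x) (fs x Mx)) fxy nth_index // fs.
Qed.

Lemma finite_index_repr M (I : finType) (f : G -> I) : M 1 ->
  exists r : I -> G, (forall i, M (r i)) /\ forall x, M x -> f (r (f x)) = f x.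
Proof.
move=> M1.
have /choice[r rP] (i : I) :
    exists g, M g /\ forall x, M x -> f x = i -> f g = i.
  have [[g [Mg fg]]|no] := pselect (exists g, M g /\ f g = i).
    by exists g; split.
  (* A label not attained on [M] gets the dummy representative [1]. *)
  by exists 1; split=> // x Mx fx; case: no; exists x.
exists r; split=> [i|x Mx]; first by case: (rP i).
by case: (rP (f x)) => _ /(_ x); exact.
Qed.

Definition core M W := [set x | M x /\ forall y, M y -> W (x ^ y)].

Lemma core_subgroup M W : subgroup M -> subgroup W -> subgroup (core M W).
Proof.
move=> [M1 MM MV] [W1 WM WV]; split.
- by split=> // y; rewrite conj1g.
- move=> x x' [Mx Wx] [Mx' Wx']; split=> [|y My]; first exact: MM.
  by rewrite conjMg; apply: WM; [exact: Wx|exact: Wx'].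
- move=> x [Mx Wx]; split=> [|y My]; first exact: MV.
  by rewrite conjVg; apply: WV; exact: Wx.
Qed.

Lemma core_normalized M W : subgroup M -> normalized_by (core M W) M.
Proof.
move=> sM x y [Mx Wx] My; split=> [|z Mz]; first exact: subgroupJ.
by rewrite -conjgM; apply: Wx; case: sM => _ + _; exact.
Qed.

(** The labels of the [x * r i] record how [x] permutes the left cosets of [W]. If [x] and [y] act
    alike, every [r i] conjugates [x^-1 * y] into [W], and any [z] in [M] is some [r i] times an
    element of [W]. *)
Lemma finite_index_core M W : subgroup M -> subgroup W ->
  finite_index M W -> finite_index M (core M W).
Proof.
move=> sM sW [I [f fW]]; have [M1 MM MV] := sM.
have [r [Mr fr]] := finite_index_repr f M1.
exists {ffun I -> I}, (fun x => [ffun i => f (x * r i)]) => x y Mx My Exy.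
split=> [|z Mz]; first by apply: MM => //; exact: MV.
have : W ((x^-1 * y) ^ r (f z)).
  rewrite (_ : _ ^ _ = (x * r (f z))^-1 * (y * r (f z))); last first.
    by rewrite /conjg !gnorm.
  apply: fW; try exact: MM.
  by have /ffunP/(_ (f z)) := Exy; rewrite !ffunE.
move=> /(@subgroupJ _ _ _ ((r (f z))^-1 * z) sW).
rewrite -conjgM mulVKg; apply.
by apply: fW => //; rewrite fr.
Qed.

(** The labels of the [r i ^ g^-1] record the conjugation action of [g] on the finite group [N / R];
    elements acting alike differ by one that acts trivially. *)
Lemma finite_index_cent_factor M N R :
    subgroup N -> subgroup R -> normalized_by R setT -> normalized_by N setT ->
    finite_index N R ->
  finite_index M [set g | forall x, N x -> R [~ x, g]].
Proof.
move=> sN sR nR nN [I [f fR]]; have [N1 NM NV] := sN; have [R1 RMul RV] := sR.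
have [r [Nr fr]] := finite_index_repr f N1.
exists {ffun I -> I}, (fun g => [ffun i => f (r i ^ g^-1)]) => g h _ _ Egh x Nx.
have Rr : R [~ r (f x), g^-1 * h].
  rewrite (_ : [~ _, _] =
      ((r (f x) ^ h^-1)^-1 * r (f x) ^ g^-1) ^ h); last first.
    by rewrite /commg /conjg !gnorm.
  apply: nR => //; apply: fR; try exact: nN.
  by have /ffunP/(_ (f x)) := Egh; rewrite !ffunE.
have Rw : R ((r (f x))^-1 * x) by apply: fR => //; rewrite fr.
rewrite (_ : [~ _, _] = ((r (f x))^-1 * x)^-1 * [~ r (f x), g^-1 * h]
   * ((r (f x))^-1 * x) ^ (g^-1 * h)); last by rewrite /commg /conjg !gnorm.
by apply: (RMul); [apply: RMul => //; exact: RV|exact: nR].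
Qed.

(** Among solvable subgroups normal in [M], take one whose label type has least cardinality. Its
    product with a conjugate is again such a subgroup, so minimality forces the conjugate inside
    it. *)
Lemma normal_radical M W :
    subgroup M -> normalized_by M setT -> subgroup W -> W `<=` M ->
    solvable_group W -> finite_index M W ->
  exists R, [/\ subgroup R, normalized_by R setT, R `<=` M,
                solvable_group R & finite_index M R].
Proof.
move=> sM nM sW WM [n Wn] fW; have [M1 MM MV] := sM.
pose good A (I : finType) (f : G -> I) :=
  [/\ subgroup A, normalized_by A M, A `<=` M, solvable_group A &
     forall x y, M x -> M y -> f x = f y -> A (x^-1 * y)].
pose P k := `[< exists A (I : finType) (f : G -> I), #|I| = k /\ good A I f >].
(* The core of [W] is a candidate: it is normalised by [M], and solvable as a subgroup of [W]. *)
have exP : exists k, P k.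
  have [I [f fC]] := finite_index_core sM sW fW.
  exists #|I|; apply/asboolP; exists (core M W), I, f; split=> //.
  have sC := core_subgroup sM sW.
  split=> //; [exact: core_normalized|by move=> x []|].
  apply: (@solvable_group_sub _ _ n) => //; rewrite -Wn.
  by apply: iter_derived_mono => // x [_ /(_ 1 M1)]; rewrite conjg1.
case: (ex_minnP exP) => k /asboolP[R [I [f [<- [sR nR RM solR fR]]]]] minI.
have R1 : R 1 by case: sR.
(* If [B] were strictly larger than [R], two values of [f] could be merged. *)
have maxR B : subgroup B -> normalized_by B M -> B `<=` M -> solvable_group B ->
    R `<=` B -> B `<=` R.
  move=> sB nB BM solB RB b Bb; have [B1 BMul BV] := sB; apply: contrapT => Rb.
  have Mb := BM _ Bb.
  have f1b : f 1 != f b.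
    by apply/eqP => /(fR _ _ M1 Mb); rewrite invg1 mul1g.
  (* Drop the label [f b] and relabel its elements [f 1]. In [M], both fibres lie in [B]: the first
     in the coset of [b] modulo [R], the second in [R]. *)
  pose J : finType := {i : I | i != f b}.
  pose j0 : J := exist _ (f 1) f1b.
  pose g x : J := insubd j0 (f x).
  have gE x : val (g x) = if f x == f b then f 1 else f x.
    by rewrite val_insubd; case: eqP.
  have ltJI : #|J| < #|I|.
    rewrite card_sig (cardD1 (f b) I) inE add1n ltnS; apply: subset_leq_card.
    by apply/fintype.subsetP => i; rewrite !inE andbT.
  suff /minI : P #|J| by rewrite leqNgt ltJI.
  apply/asboolP; exists B, J, g; split=> //; split=> // x y Mx My.
  move=> /(congr1 val); rewrite !gE.
  have eqb z : M z -> f z = f b -> B z.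
    move=> Mz fzb; have /RB Bzb := fR _ _ Mb Mz (esym fzb).
    by rewrite -[z](mulVKg b); exact: BMul.
  have eq1 z : M z -> f z = f 1 -> B z.
    move=> Mz fz1; apply: RB.
    by rewrite -[z]mul1g -[X in X * _]invg1; exact: fR.
  case: eqP => [xb|_]; case: eqP => [yb|_] xy.
  - by apply: BMul; [apply: BV|]; exact: eqb.
  - by apply: BMul; [apply: BV; exact: eqb|exact: eq1].
  - by apply: BMul; [apply: BV; exact: eq1|exact: eqb].
  - by apply: RB; exact: fR.
exists R; split=> // [x y Rx _|]; last by exists I, f.
pose Ry := [set x | R (x ^ y^-1)].
have sRy : subgroup Ry.
  case: sR => _ RMul RV; split=> [|u v|u];
    rewrite /Ry /= ?conj1g ?conjMg ?conjVg //.
  - exact: RMul.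
  - exact: RV.
have RyM : Ry `<=` M by move=> u /RM /(nM _ y)/(_ Logic.I); rewrite conjgKV.
have nRyM : normalized_by Ry M.
  by move=> u v Ru Mv; rewrite /Ry /= conjJg; apply: nR => //; exact: nM.
apply: (maxR (mul_set R Ry)).
- apply: mul_set_subgroup => // u v Ru /RyM; exact: nR.
- move=> _ v [a Ra [c Rc <-]] Mv; rewrite conjMg.
  by exists (a ^ v); [exact: nR|exists (c ^ v) => //; exact: nRyM].
- by move=> _ [a /RM Ma [c /RyM Mc <-]]; exact: MM.
- apply: mul_set_solvable => //; first by move=> u v Ru /RyM; exact: nR.
  exact: solvable_group_conj.
- by move=> a Ra; exists a => //; exists 1; [case: sRy|rewrite mulg1].
- by exists 1 => //; exists (x ^ y); [rewrite /Ry /= conjgK|rewrite mul1g].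
Qed.

End FiniteIndex.

(** * Neumann's argument in bounded FC-groups *)

Section BoundedFC.
Variable Q : groupType.
Implicit Types (F : set Q) (s : seq Q).

Definition centraliser_seq F s :=
  [set x | F x /\ forall b, b \in s -> commute b x].

Lemma centraliser_seq_subgroup F s :
  subgroup F -> subgroup (centraliser_seq F s).
Proof.
move=> [F1 FM FV]; split.
- by split=> // b _; exact: commute1.
- move=> x y [Fx Cx] [Fy Cy]; split=> [|b bs]; first exact: FM.
  by apply: commuteM; [exact: Cx|exact: Cy].
- by move=> x [Fx Cx]; split=> [|b bs]; [exact: FV|apply: commuteV; exact: Cx].
Qed.

Lemma finite_index_centraliser_seq F s : subgroup F -> FC_group F ->
  (forall b, b \in s -> F b) -> finite_index F (centraliser_seq F s).
Proof.
move=> sF FCF; have [F1 FM FV] := sF.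
elim: s => [|b s IHs] Fs.
  exists unit, (fun=> tt) => x y Fx Fy _; split=> //.
  by apply: FM => //; exact: FV.
have Fb : F b by apply: Fs; rewrite mem_head.
have /IHs : forall c, c \in s -> F c.
  by move=> c cs; apply: Fs; rewrite in_cons cs orbT.
(* Conjugating by [u^-1] rather than [u] makes equal values mean equal left cosets of the
   centraliser of [b]. *)
have : finite_index F [set x | commute b x].
  apply: (@finite_index_image _ _ _ _ (fun u => b ^ u^-1)).
    apply: sub_finite_set (FCF _ Fb) => _ [u Fu <-].
    by exists u^-1 => //; exact: FV.
  move=> u v _ _ Euv; apply/commgP/conjg_fixP.
  by rewrite conjgM Euv conjgKV.
move=> fb fs; apply: finite_indexS (finite_indexI fb fs) => // x [bx [Fx sx]].
by split=> // c; rewrite in_cons => /predU1P[->//|]; exact: sx.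
Qed.

(* B. H. Neumann's argument: if the class [L] of [a] has maximal size, then for
   all [u] centralising the conjugators, the class of [u * a] is [u * L];
   hence [[u, x]] lies in the finite set [L / L]. *)
Lemma bounded_FC_nilpotent_subgroup F : subgroup F -> FC_group F ->
    bounded_FC_group F ->
  exists W, [/\ subgroup W, W `<=` F, finite_index F W &
    forall x y z, W x -> W y -> W z -> [~ [~ x, y], z] = 1].
Proof.
move=> sF FCF [m bF]; have [F1 FM FV] := sF.
(* Here [k] counts distinct conjugates of one element, listed by conjugators in [s]; the bound [m]
   on class sizes provides a maximum. *)
pose P k := `[< exists a s, [/\ F a, (forall b, b \in s -> F b),
                  uniq [seq a ^ b | b <- s] & size s = k] >].
have exP : exists k, P k by exists 0; apply/asboolP; exists 1, [::].
have ubP k : P k -> k <= m.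
  move=> /asboolP[a [s [Fa Fs us <-]]].
  rewrite -(size_map (conjg a)) -card_le_II.
  apply: card_le_trans (bF _ Fa); set L := [seq _ | _ <- _] in us *.
  have injL : set_inj `I_(size L) (nth 1 L).
    by move=> i j /set_mem iL /set_mem jL /eqP; rewrite nth_uniq // => /eqP.
  rewrite -(card_le_eql (inj_card_eq injL)); apply: subset_card_le.
  move=> _ [i iL <-]; have /mapP[b bs ->] := mem_nth 1 iL.
  by exists b => //; exact: Fs.
case: (ex_maxnP exP ubP) => k /asboolP[a [s [Fa Fs us sk]]] maxk.
pose L := [seq a ^ b | b <- s].
have LF p : p \in L -> F p by move=> /mapP[b /Fs Fb ->]; exact: subgroupJ.
pose U := centraliser_seq F s.
have classU u x : U u -> F x -> exists2 p, p \in L & (u * a) ^ x = u * p.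
  move=> [Fu Cu] Fx.
  (* As [u] commutes with [s], the translates [u * p] are [k] distinct conjugates of [u * a]; one
     more would contradict maximality. *)
  have Es : [seq (u * a) ^ b | b <- s] = [seq u * p | p <- L].
    rewrite -map_comp; apply/eq_in_map => b bs /=.
    rewrite conjMg; congr (_ * _).
    by apply/conjg_fixP/commgP/commute_sym; exact: Cu.
  suff : (u * a) ^ x \in [seq (u * a) ^ b | b <- s].
    by rewrite Es => /mapP[p pL ->]; exists p.
  apply: contrapT => /negP nx; suff /maxk : P k.+1 by rewrite ltnn.
  apply/asboolP; exists (u * a), (x :: s); split=> /=.
  - exact: FM.
  - by move=> b; rewrite in_cons => /predU1P[->|/Fs].
  - by rewrite nx Es map_inj_uniq //; exact: mulgI.
  - by rewrite sk.
pose D := [seq p * q^-1 | p <- L, q <- L].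
have commD u x : U u -> F x -> [~ u, x] \in D.
  move=> Uu Fx; have [p pL Ep] := classU _ _ Uu Fx.
  (* The case [u = 1] gives [a ^ x = q]; dividing [(u * a) ^ x = u * p] by it yields
     [u ^ x = u * (p * q^-1)]. *)
  have U1 : U 1 by case: (centraliser_seq_subgroup s sF).
  have [q qL] := classU _ _ U1 Fx; rewrite !mul1g => Eq.
  suff -> : [~ u, x] = p * q^-1 by apply/allpairsP; exists (p, q).
  apply: (mulgI u); rewrite [RHS]mulgA -Ep -Eq.
  by rewrite /commg /conjg !gnorm.
have Fsd b : b \in s ++ D -> F b.
  rewrite mem_cat => /orP[/Fs//|/allpairsP[[p q] /= [/LF Fp /LF Fq ->]]].
  by apply: FM => //; exact: FV.
(* Centralising [s] puts commutators into [D]; centralising [D] then kills the commutators of weight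
   three. *)
exists (centraliser_seq F (s ++ D)); split.
- exact: centraliser_seq_subgroup.
- by move=> x [].
- exact: finite_index_centraliser_seq.
- move=> x y z [Fx Cx] [Fy _] [_ Cz]; apply/eqP/commgP; apply: Cz.
  rewrite mem_cat commD ?orbT //; split=> // b bs.
  by apply: Cx; rewrite mem_cat bs.
Qed.

End BoundedFC.

(** * Extension by a bounded FC factor *)

Section Extension.
Variable G : groupType.

(* Let [C] be the centraliser of the finite group [N / R].  If [W] lies in
   [C] and has class 2 modulo [N], then [W''' <= R]. *)
Lemma solvable_by_finite_extension (N M : normal_subgroup G) (R : set G) :
    N `<=` M -> FC_group (factor N M) -> bounded_FC_group (factor N M) ->
    subgroup R -> normalized_by R setT -> solvable_group R -> R `<=` N ->
    finite_index N R ->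
  exists S, [/\ subgroup S, normalized_by S setT, S `<=` M,
                solvable_group S & finite_index M S].
Proof.
case: M => M sM /= nM NM FCF bF sR nR [n Rn] RN fR.
have [M1 MM MV] := sM; have sN := normal_subgroupP N.
have cM := @cosetM G N.
have c1 : coset N 1 = 1 by apply: (mulgI (coset N 1)); rewrite -cM !mulg1.
have cV x : coset N x^-1 = (coset N x)^-1.
  by apply: (mulgI (coset N x)); rewrite -cM !mulgV.
have cR x y : coset N [~ x, y] = [~ coset N x, coset N y].
  by rewrite /commg /conjg !cM !cV.
have sF : subgroup (factor N M).
  split; first by exists 1.
  - by move=> _ _ [x Mx <-] [y My <-]; exists (x * y); [exact: MM|rewrite cM].
  - by move=> _ [x Mx <-]; exists x^-1; [exact: MV|rewrite cV].
have [V [sV _ [I [f fV]] nilV]] := bounded_FC_nilpotent_subgroup sF FCF bF.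
pose C := [set g | forall x, normal_set N x -> R [~ x, g]].
have sC : subgroup C.
  have [R1 RMul RV] := sR; split.
  - by move=> x _; rewrite commg1.
  - move=> g h Cg Ch x Nx.
    rewrite (_ : [~ _, _] = [~ x, h] * [~ x, g] ^ h); last first.
      by rewrite /commg /conjg !gnorm.
    by apply: RMul; [exact: Ch|apply: nR => //; exact: Cg].
  - move=> g Cg x Nx.
    rewrite (_ : [~ _, _] = [~ x, g]^-1 ^ g^-1).
      by apply: nR => //; apply: RV; exact: Cg.
    by rewrite /commg /conjg !gnorm.
pose W := [set x | M x /\ V (coset N x)] `&` C.
have sMV : subgroup [set x | M x /\ V (coset N x)].
  have [V1 VM VV] := sV; split.
  - by split=> //; rewrite c1.
  - by move=> x y [Mx Vx] [My Vy]; split; [exact: MM|rewrite cM; exact: VM].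
  - by move=> x [Mx Vx]; split; [exact: MV|rewrite cV; exact: VV].
have sW : subgroup W by exact: subgroupI.
apply: (normal_radical (W := W)) => //.
- by move=> x y Mx _; exact: nM.
- by move=> x [[]].
(* [Z] is the centraliser of [V]; it contains the derived subgroup of [V], which is therefore
   abelian. *)
- have V2 : iter 2 (@derived_subgroup _) V `<=` [set 1].
    pose Z := [set x | forall z, V z -> [~ x, z] = 1].
    have sZ : subgroup Z.
      split=> [z _|x y Zx Zy z Vz|x Zx z Vz]; first exact: comm1g.
        apply/eqP/commgP/commute_sym/commuteM; apply/commute_sym/commgP/eqP.
          exact: Zx.
        exact: Zy.
      apply/eqP/commgP/commute_sym/commuteV/commute_sym/commgP/eqP.
      exact: Zx.
    have V1 : derived_subgroup V `<=` Z.
      by apply: derived_subgroup_sub => // x y Vx Vy z Vz; exact: nilV.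
    apply: derived_subgroup_sub.
      split=> // [_ _ -> ->|_ ->]; rewrite /= ?mulg1 ?invg1 //.
    by move=> x y /V1 Zx /(@iter_derived_sub _ _ 1 sV); exact: Zx.
  have W2 : iter 2 (@derived_subgroup _) W `<=` N `&` C.
    move=> x Wx; split; last by have [] := iter_derived_sub sW Wx.
    have : iter 2 (@derived_subgroup _) V (coset N x).
      by apply: (iter_derived_morph cM sV) Wx => y [[]].
    move=> /V2 /=; rewrite -c1 => /esym/cosetP.
    by rewrite invg1 mul1g.
  have W3 : iter 3 (@derived_subgroup _) W `<=` R.
    by apply: derived_subgroup_sub => // x y /W2[Nx _] /W2[_ Cy]; exact: Cy.
  apply: (@solvable_group_sub _ _ (n + 3)) => //; rewrite iterD -Rn.
  exact: iter_derived_mono.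
(* The preimage of [V] inherits its labels through [coset N]; [C] has finite index by the action on
   [N / R]. *)
- apply: finite_indexI.
    exists I, (f \o coset N) => x y Mx My /= fxy; split.
      by apply: MM => //; exact: MV.
    by rewrite cM cV; apply: fV => //; [exists x|exists y].
  apply: finite_index_cent_factor => //.
  by move=> x y Nx _; exact: normal_conjP.
Qed.

End Extension.

(** * Induction along the chain *)

Theorem mainTheorem3 (G : groupType) :
  bounded_FC_solvable G -> solvable_by_finite G.
Proof.
move=> [n [N [[[N0 Nn NS] FCN] bN]]].
have ind i : i <= n -> exists R, [/\ subgroup R, normalized_by R setT,
    R `<=` N i, solvable_group R & finite_index (N i) R].
  elim: i => [_|i IHi ltin].
    exists [set 1]; rewrite N0; split=> //.
    - by split=> // [_ _ -> ->|_ ->]; rewrite /= ?mulg1 ?invg1.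
    - by move=> _ y -> _; rewrite /= conj1g.
    - by exists 0.
    - by exists unit, (fun=> tt) => _ _ -> -> _; rewrite /= invg1 mulg1.
  have [R [sR nR RN solR fR]] := IHi (ltnW ltin).
  apply: (@solvable_by_finite_extension _ (N i) _ R) => //;
    [exact: NS|exact: FCN|exact: bN].
have [R [sR nR _ solR []]] := ind n (leqnn n).
rewrite Nn => I [f fR].
exists (NormalSubgroup sR (fun x y Rx => nR x y Rx Logic.I)); split=> //.
set K := NormalSubgroup _ _.
(* Labels of chosen representatives embed the quotient into the finite type [I]. *)
have inj : set_inj [set: quotient K] (fun a : quotient K => f (repr a)).
  move=> a b _ _ fab; rewrite -(coset_repr a) -(coset_repr b).
  by apply/cosetP; exact: fR.
apply: (@card_le_finite _ _ _ [set: I]); last exact: finite_finset.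
by rewrite -(card_le_eql (inj_card_eq inj)); exact: subset_card_le.
Qed.
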